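(* Let $s\in(0,1)$ and let $\Omega\subset\mathbb{R}^n$ be a bounded domain. Let $I\subseteq\mathbb{R}$ and, for every $t\in I$, let $G^{(t)}\subseteq\mathbb{R}^n$ be a measurable set. Assume that for each $t\in I$ there is an admissible set of finite $s$-perimeter with exterior datum $G^{(t)}$, i.e. a measurable set $F$ with $F\setminus\Omega=G^{(t)}\setminus\Omega$ and $\operatorname{Per}_s(F,\Omega)<+\infty$. Assume moreover that for all $t_1,t_2\in I$ with $t_1<t_2$ one has $G^{(t_1)}\setminus\Omega\subsetneq G^{(t_2)}\setminus\Omega$. Then there exists an (at most) countable set $N\subset I$ such that, for all $t\in I\setminus N$, there is a unique $s$-perimeter minimizer in $\Omega$ with exterior datum $G^{(t)}$ (that is, a unique $s$-minimal set $E$ in $\Omega$ with $E\setminus\Omega=G^{(t)}\setminus\Omega$).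
   Context: All sets are measurable, and all identities between sets (equalities, inclusions, strict inclusions, uniqueness) are understood up to sets of Lebesgue measure zero; in particular $A\subsetneq B$ means $|A\setminus B|=0$ and $|B\setminus A|>0$. The superscript $c$ denotes the complement in $\mathbb{R}^n$. For disjoint sets $E,F\subseteq\mathbb{R}^n$ let $I_s(E,F):=\iint_{E\times F}\frac{dx\,dy}{|x-y|^{n+s}}$. The $s$-perimeter of $E$ in $\Omega$ is $$\operatorname{Per}_s(E,\Omega):=I_s(E\cap\Omega,E^c\cap\Omega)+I_s(E\cap\Omega,E^c\cap\Omega^c)+I_s(E\cap\Omega^c,E^c\cap\Omega).$$ A set $E$ is $s$-minimal in $\Omega$ (an $s$-perimeter minimizer in $\Omega$) if $\operatorname{Per}_s(E,\Omega)\le\operatorname{Per}_s(F,\Omega)$ for every $F$ with $F\setminus\Omega=E\setminus\Omega$. *)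

(* Defs.v *)
From HB Require Import structures.
From mathcomp Require Import all_boot all_order all_algebra.
From mathcomp Require Import all_classical all_reals all_analysis.

Set Implicit Arguments.
Unset Strict Implicit.
Unset Printing Implicit Defensive.
Import Order.TTheory GRing.Theory Num.Theory.
Import numFieldNormedType.Exports.
Local Open Scope classical_set_scope.
Local Open Scope ring_scope.

(** R^n is ['rV[R]_n.+1] (so n >= 1 is written [n.+1]).  Its library topology
    and bounded sets are those of the sup norm, hence the Euclidean ones; the
    Euclidean norm itself is [enorm] below. *)

Section lebesgue_outer_measure.
Context (R : realType) (n : nat).
Implicit Types (A : set 'rV[R]_n.+1) (a b : 'rV[R]_n.+1).

Definition box (ab : 'rV[R]_n.+1 * 'rV[R]_n.+1) : set 'rV[R]_n.+1 :=
  [set x | forall i, ab.1 ord0 i < x ord0 i <= ab.2 ord0 i].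

Definition box_volume (ab : 'rV[R]_n.+1 * 'rV[R]_n.+1) : R :=
  \prod_(i < n.+1) Num.max 0 (ab.2 ord0 i - ab.1 ord0 i).

Definition lebesgue_outer A : \bar R :=
  ereal_inf [set (\sum_(k <oo) (box_volume (B k))%:E)%E |
             B in [set B : nat -> 'rV[R]_n.+1 * 'rV[R]_n.+1 |
                   A `<=` \bigcup_k box (B k)]].

Lemma box_volume_ge0 ab : 0 <= box_volume ab.
Proof. by apply: prodr_ge0 => i _; rewrite le_max lexx. Qed.

Local Open Scope ereal_scope.

Let vol_ge0 ab : 0 <= (box_volume ab)%:E.
Proof. by rewrite lee_fin box_volume_ge0. Qed.

Lemma lebesgue_outer_ge0 A : 0 <= lebesgue_outer A.
Proof. by apply: le_ereal_inf_tmp => _ [B _ <-]; exact: nneseries_ge0. Qed.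

Lemma lebesgue_outer0 : lebesgue_outer set0 = 0.
Proof.
apply/eqP; rewrite eq_le lebesgue_outer_ge0 andbT.
apply: ereal_inf_lbound; exists (fun=> (0%R, 0%R)); first by move=> x.
apply: eseries0 => k _ _.
by rewrite /box_volume big_ord_recl /= subrr maxxx mul0r.
Qed.

Lemma le_lebesgue_outer : {homo lebesgue_outer : A B / A `<=` B >-> A <= B}.
Proof.
move=> A B AB; apply/ereal_inf_le_tmp => x [C BC <-].
by exists C => //; exact: subset_trans AB BC.
Qed.

Lemma lebesgue_outer_sigma_subadditive : sigma_subadditive lebesgue_outer.
Proof.
move=> A; have [[i ioo]|] := pselect (exists i, lebesgue_outer (A i) = +oo).
  rewrite (eseries_pinfty _ _ ioo) ?leey// => k _.
  by rewrite -ltNye (lt_le_trans _ (lebesgue_outer_ge0 _)).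
rewrite -forallNE => Aoo.
suff add2e (e : {posnum R}) : lebesgue_outer (\bigcup_k A k) <=
    \sum_(i <oo) lebesgue_outer (A i) + e%:num%:E.
  by apply/lee_addgt0Pr => _/posnumP[].
rewrite (le_trans _ (epsilon_trick _ _ _))//; last first.
  by move=> k; exact: lebesgue_outer_ge0.
pose P k (B : nat -> 'rV[R]_n.+1 * 'rV[R]_n.+1) :=
  A k `<=` \bigcup_j box (B j) /\
  \sum_(j <oo) (box_volume (B j))%:E <=
    lebesgue_outer (A k) + (e%:num / (2 ^ k.+1)%:R)%:E.
have [G PG] : {G & forall k, P k (G k)}.
  apply: (@choice _ _ P) => k.
  have fin : lebesgue_outer (A k) \is a fin_num.
    by rewrite ge0_fin_numE ?lebesgue_outer_ge0// ltey; exact/eqP/Aoo.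
  have ek : (0 < e%:num / (2 ^ k.+1)%:R :> R)%R by [].
  have [_ [B AB <-] /ltW lB] := lb_ereal_inf_adherent ek fin.
  by exists B.
pose v (ij : nat * nat) := (box_volume (G ij.1 ij.2))%:E.
have v0 ij : 0 <= v ij by exact: vol_ge0.
apply: (@le_trans _ _ (\esum_(ij in setT) v ij)).
  apply: ereal_inf_lbound.
  have /card_esym/ppcard_eqP[f] := card_nat2.
  exists (fun k => G (f k).1 (f k).2) => /=.
    move=> x [i _ /((PG i).1 x)[j _ Gx]].
    by exists (f^-1%FUN (i, j)) => //=; rewrite invK ?inE.
  rewrite -[LHS]/(\sum_(k <oo) (v \o f) k) nneseries_esumT; last first.
    by move=> k; exact: v0.
  by rewrite (reindex_esum setT setT f).
rewrite (_ : esum _ _ = \sum_(i <oo) \sum_(j <oo) v (i, j)); last first.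
  rewrite nneseries_esumT; last by move=> i; exact: nneseries_ge0.
  rewrite (eq_esum (fun i _ => nneseries_esumT (fun j => v0 (i, j)))) esum_esum//.
  by congr esum; apply/seteqP; split=> -[].
by apply: lee_nneseries => [i _ _|i _]; [exact: nneseries_ge0|exact: (PG i).2].
Qed.

HB.instance Definition _ := isOuterMeasure.Build R 'rV[R]_n.+1 lebesgue_outer
  lebesgue_outer0 lebesgue_outer_ge0 le_lebesgue_outer
  lebesgue_outer_sigma_subadditive.

End lebesgue_outer_measure.

Arguments lebesgue_outer R n A : clear implicits.

(** The Lebesgue sigma-algebra (Caratheodory-measurable sets, not only Borel
    ones) and Lebesgue measure on R^n. *)
Notation lebesgueType R n := (caratheodory_type (lebesgue_outer R n)).

Definition lebesgue (R : realType) (n : nat) :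
  set (lebesgueType R n) -> \bar R := lebesgue_outer R n.

HB.instance Definition _ (R : realType) (n : nat) :=
  isMeasure.Build _ (lebesgueType R n) R (@lebesgue R n)
    (@caratheodory_measure0 _ _ (lebesgue_outer R n))
    (@caratheodory_measure_ge0 _ _ (lebesgue_outer R n))
    (@caratheodory_measure_sigma_additive _ _ (lebesgue_outer R n)).

Section s_perimeter.
Context (R : realType) (n : nat).
Local Notation Rn := 'rV[R]_n.+1.
Implicit Types (Omega E F : set Rn) (s : R).

Definition lebesgue_measurable E : Prop :=
  measurable (E : set (lebesgueType R n)).

Definition subset_ae E F : Prop := lebesgue (E `\` F) = 0%E.
Definition eq_ae E F : Prop := lebesgue (E `+` F) = 0%E.
Definition proper_ae E F : Prop :=
  subset_ae E F /\ (0 < lebesgue (F `\` E))%E.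

Definition enorm (x : Rn) : R := Num.sqrt (\sum_(i < n.+1) x ord0 i ^+ 2).

(** On the diagonal the kernel takes the junk value 0; [interaction] is only
    used for disjoint sets. *)
Definition s_kernel s (x y : Rn) : R := (enorm (x - y) `^ (n.+1%:R + s))^-1.

Definition interaction s E F : \bar R :=
  (\int[@lebesgue R n \x @lebesgue R n]_(z in (E : set (lebesgueType R n)) `*`
     (F : set (lebesgueType R n))) (s_kernel s z.1 z.2)%:E)%E.

Definition s_perimeter s E Omega : \bar R :=
  (interaction s (E `&` Omega) (~` E `&` Omega)
   + interaction s (E `&` Omega) (~` E `&` ~` Omega)
   + interaction s (E `&` ~` Omega) (~` E `&` Omega))%E.

Definition same_exterior Omega E F : Prop := eq_ae (E `\` Omega) (F `\` Omega).

Definition s_minimal s Omega E : Prop :=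
  lebesgue_measurable E /\
  forall F, lebesgue_measurable F -> same_exterior Omega F E ->
    (s_perimeter s E Omega <= s_perimeter s F Omega)%E.

Definition bounded_domain Omega : Prop :=
  [/\ open Omega, connected Omega, Omega !=set0 & bounded_set Omega].

End s_perimeter.

(* Main.v *)
Require Import Defs.
From HB Require Import structures.
From mathcomp Require Import all_boot all_order all_algebra.
From mathcomp Require Import all_classical all_reals all_analysis.
From mathcomp Require Import measurable_realfun lra.
Set Implicit Arguments.
Unset Strict Implicit.
Unset Printing Implicit Defensive.
Import Order.TTheory GRing.Theory Num.Theory.
Import numFieldNormedType.Exports.
Local Open Scope classical_set_scope.
Local Open Scope ring_scope.

(** The s-perimeter is submodular, P(E∩F) + P(E∪F) <= P(E) + P(F), and the
    defect dominates the interaction of E\F with F\E across Omega.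

    Existence needs no compactness: if P(E_k) <= m + 2^-k with m the infimum,
    then submodularity bounds P of the finite intersections E_j ∩ ... ∩ E_(j+N)
    by m + 2·2^-j, and Fatou's lemma, applied first as N and then as j tends to
    infinity, shows that liminf E_k is a minimizer.

    Comparison: if E and F minimize for t1 < t2, then E∩F and E∪F are
    competitors, so the defect vanishes; as F\E has positive measure outside
    Omega and the kernel is positive, E is contained in F.

    Hence, if t has two distinct minimizers, their intersection and union are
    minimizers whose volumes in Omega are separated by a rational q_t, and t |->
    q_t is strictly increasing, so there are countably many such t. *)

(** * Lebesgue measure on R^n *)

Section lebesgue_theory.
Context (R : realType) (n : nat).
Local Notation Rn := 'rV[R]_n.+1.
Local Notation leb := (lebesgue_outer R n).

Definition set_coord (a : Rn) (i : 'I_n.+1) (c : R) : Rn :=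
  \row_j (if j == i then c else a ord0 j).

Definition halfspace (i : 'I_n.+1) (c : R) : set Rn := [set x | x ord0 i <= c].

(** The hyperplane [x i = c] cuts a box in two; if it misses the box, one half is degenerate and
    [box_volume] gives it volume 0. *)
Definition box_below i c (ab : Rn * Rn) :=
  (ab.1, set_coord ab.2 i (Num.min (ab.2 ord0 i) c)).

Definition box_above i c (ab : Rn * Rn) :=
  (set_coord ab.1 i (Num.max (ab.1 ord0 i) c), ab.2).

Lemma sub_box_below i c ab :
  box ab `&` halfspace i c `<=` box (box_below i c ab).
Proof.
move=> x [/= abx xc] j; rewrite /= mxE; case: eqP => [->|_]; last exact: abx.
by rewrite le_min xc; have /andP[-> ->] := abx i.
Qed.

Lemma sub_box_above i c ab :
  box ab `&` ~` halfspace i c `<=` box (box_above i c ab).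
Proof.
move=> x [/= abx /negP]; rewrite -ltNge => cx j.
rewrite /= mxE; case: eqP => [->|_]; last exact: abx.
by rewrite gt_max cx; have /andP[-> ->] := abx i.
Qed.

Lemma side_split (a b c : R) :
  Num.max 0 (Num.min b c - a) + Num.max 0 (b - Num.max a c) = Num.max 0 (b - a).
Proof. by rewrite /Num.max /Num.min; repeat case: ifPn; rewrite -?leNgt; lra. Qed.

Lemma box_volume_split i c ab :
  box_volume (box_below i c ab) + box_volume (box_above i c ab) =
  box_volume ab.
Proof.
rewrite /box_volume 3!(bigD1 (op := *%R) i isT)/= !mxE eqxx.
set p := \prod_(_ < _ | _) _; set q := \prod_(_ < _ | _) _.
set r := \prod_(_ < _ | _) _.
have -> : p = r by apply: eq_bigr => j /negbTE ji; rewrite mxE ji.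
have -> : q = r by apply: eq_bigr => j /negbTE ji; rewrite mxE ji.
by rewrite -mulrDl side_split.
Qed.

(** Cutting every box of a cover of [X] along the hyperplane gives covers of the two parts of [X]
    with the same total volume, which is Caratheodory's criterion. *)
Lemma halfspace_measurable i c : lebesgue_measurable (halfspace i c).
Proof.
apply: le_caratheodory_measurable => X.
apply: le_ereal_inf_tmp => _ [B XB <-].
rewrite (eq_eseriesr (g := fun k => (box_volume (box_below i c (B k)))%:E +
   (box_volume (box_above i c (B k)))%:E)%E); last first.
  by move=> k _; rewrite -EFinD box_volume_split.
rewrite nneseriesD; do ?by move=> k _ _; rewrite lee_fin box_volume_ge0.
apply: leeD; apply: ereal_inf_lbound.
- exists (fun k => box_below i c (B k)) => // x [Xx cx].
  by have [k _ Bx] := XB _ Xx; exists k => //; apply: sub_box_below.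
- exists (fun k => box_above i c (B k)) => // x [Xx cx].
  by have [k _ Bx] := XB _ Xx; exists k => //; apply: sub_box_above.
Qed.

Lemma coord_measurable i :
  measurable_fun setT (fun x : lebesgueType R n => (x : Rn) ord0 i).
Proof.
apply: (measurability _ (RGenOInfty.measurableE R)) => _ [_ [c ->] <-].
rewrite setTI.
rewrite (_ : _ @^-1` _ = ~` (halfspace i c : set (lebesgueType R n))).
  exact/measurableC/halfspace_measurable.
apply/seteqP; split => x /=; rewrite in_itv/= andbT ltNge => /negP//.
Qed.

(** Indexing by an [ffun] of rationals makes this family countable, hence also the union in
    [open_lebesgue_measurable]. *)
Definition open_rat_box (q : {ffun 'I_n.+1 -> rat * rat}) : set Rn :=
  [set x | forall i, ratr (q i).1 < x ord0 i < ratr (q i).2].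

Lemma open_rat_box_measurable q : lebesgue_measurable (open_rat_box q).
Proof.
rewrite /lebesgue_measurable.
rewrite (_ : open_rat_box q = \bigcap_(i in setT)
  ((fun x : lebesgueType R n => (x : Rn) ord0 i) @^-1`
    `](ratr (q i).1), (ratr (q i).2)[%classic)); last first.
  apply/seteqP; split => x /= qx.
    by move=> i _; rewrite /= in_itv/=; exact: qx.
  by move=> i; have := qx i Logic.I; rewrite /= in_itv.
apply: fin_bigcap_measurable => [|i _]; first exact: finite_finset.
by rewrite -[X in measurable X]setTI; apply: coord_measurable.
Qed.

Lemma open_lebesgue_measurable (U : set Rn) : open U -> lebesgue_measurable U.
Proof.
move=> oU; rewrite /lebesgue_measurable.
rewrite (_ : U = \bigcup_(q in [set q | open_rat_box q `<=` U]) open_rat_box q).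
  rewrite bigcup_mkcond; apply: countable_bigcupT_measurable => // q.
  by case: ifP => _ //; exact: open_rat_box_measurable.
apply/seteqP; split=> [x Ux|x [q qU qx]]; last exact: qU.
have /nbhs_ballP[e /= e0 eU] : nbhs x U by exact: open_nbhs_nbhs.
(* Balls are those of the sup norm, that is cubes, so rational bounds within [e] of each coordinate
   give a box around [x] inside [U]. *)
have [l lx] : {l : 'I_n.+1 -> rat & forall i, x ord0 i - e < ratr (l i) < x ord0 i}.
  apply: (@choice _ _ (fun i (q : rat) => x ord0 i - e < ratr q < x ord0 i)) => i.
  have [|q] := @rat_in_itvoo R (x ord0 i - e) (x ord0 i); first by lra.
  by rewrite in_itv/= => ?; exists q.
have [u ux] : {u : 'I_n.+1 -> rat & forall i, x ord0 i < ratr (u i) < x ord0 i + e}.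
  apply: (@choice _ _ (fun i (q : rat) => x ord0 i < ratr q < x ord0 i + e)) => i.
  have [|q] := @rat_in_itvoo R (x ord0 i) (x ord0 i + e); first by lra.
  by rewrite in_itv/= => ?; exists q.
exists [ffun i => (l i, u i)].
  move=> y yq; apply: eU; split=> // i j; rewrite (ord1 i) /ball/=.
  have := yq j; have := lx j; have := ux j; rewrite ffunE/= ltr_norml; lra.
move=> i; rewrite ffunE/=; have := lx i; have := ux i; lra.
Qed.

Lemma lebesgue_box (ab : Rn * Rn) : (@lebesgue R n (box ab) < +oo)%E.
Proof.
(* Covers are sequences, so [ab] is padded with degenerate boxes of volume 0. *)
pose B k := if k is 0%N then ab else (0, 0) : Rn * Rn.
apply: (@le_lt_trans _ _ (\sum_(k <oo) (box_volume (B k))%:E)%E).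
  by apply: ereal_inf_lbound; exists B => // x abx; exists 0%N.
rewrite nneseries_recl//; last by move=> k _; rewrite lee_fin box_volume_ge0.
rewrite eseries0 ?adde0 ?ltry// => -[|k] // _ _.
by rewrite /= /box_volume big_ord_recl /= subrr maxxx mul0r.
Qed.

Lemma box_measurable (ab : Rn * Rn) : lebesgue_measurable (box ab).
Proof.
rewrite /lebesgue_measurable.
rewrite (_ : box ab = \bigcap_(i in setT)
  ((fun x : lebesgueType R n => (x : Rn) ord0 i) @^-1`
    `](ab.1 ord0 i), (ab.2 ord0 i)]%classic)); last first.
  apply/seteqP; split => x /= qx.
    by move=> i _; rewrite /= in_itv/=; exact: qx.
  by move=> i; have := qx i Logic.I; rewrite /= in_itv.
apply: fin_bigcap_measurable => [|i _]; first exact: finite_finset.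
by rewrite -[X in measurable X]setTI; apply: coord_measurable.
Qed.

Lemma sub_box_norm (M : R) (x : Rn) : `|x| < M -> box (const_mx (- M), const_mx M) x.
Proof.
move=> xM i; rewrite !mxE /=.
have /le_lt_trans/(_ xM) : `|x ord0 i| <= `|x|.
  rewrite -[leRHS]/(mx_norm x) mx_normrE.
  exact: (le_bigmax_cond _ (fun ij => `|x ij.1 ij.2|) (j := (ord0, i))).
by rewrite ltr_norml; lra.
Qed.

Lemma lebesgue_sigma_finite : sigma_finite setT (@lebesgue R n).
Proof.
exists (fun k : nat => box (const_mx (- k%:R), const_mx k%:R)).
  apply/seteqP; split => // x _; exists (Num.trunc `|x|).+1 => //.
  by apply: sub_box_norm; apply: truncnS_gt.
by move=> k; split; [exact: box_measurable|exact: lebesgue_box].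
Qed.

(** Sigma-finiteness makes the product of [lebesgue] with itself a measure, as Fatou's lemma and the
    rectangle formula require. *)
HB.instance Definition _ := @Measure_isSigmaFinite.Build _ (lebesgueType R n) R
  (@lebesgue R n) lebesgue_sigma_finite.

Lemma bounded_lebesgue (A : set Rn) : bounded_set A -> (@lebesgue R n A < +oo)%E.
Proof.
move=> [M [_ AM]].
apply: (@le_lt_trans _ _ (@lebesgue R n
    (box (const_mx (- (`|M| + 2)), const_mx (`|M| + 2) : Rn)))).
  apply: le_lebesgue_outer => x Ax; apply: sub_box_norm.
  apply: (@le_lt_trans _ _ (`|M| + 1)); last by lra.
  by apply: AM Ax; have := ler_norm M; lra.
exact: lebesgue_box.
Qed.

Lemma s_kernel_measurable s : measurable_fun setT
  (fun z : lebesgueType R n * lebesgueType R n => s_kernel s (z.1 : Rn) z.2).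
Proof.
rewrite /s_kernel; under eq_fun do rewrite -powRN.
apply: (measurableT_comp (measurable_powR (- (n.+1%:R + s)))).
apply: (measurableT_comp (continuous_measurable_fun (@sqrt_continuous R))).
apply: measurable_sum => i; apply: measurable_funX.
under eq_fun do rewrite !mxE.
apply: measurable_funB.
  exact: (measurableT_comp (coord_measurable i) measurable_fst).
exact: (measurableT_comp (coord_measurable i) measurable_snd).
Qed.

Lemma s_kernel_ge0 s (x y : Rn) : 0 <= s_kernel s x y.
Proof. by rewrite invr_ge0 powR_ge0. Qed.

Lemma s_kernel_gt0 s (x y : Rn) : x <> y -> 0 < s_kernel s x y.
Proof.
move=> xy; rewrite invr_gt0; apply: powR_gt0; rewrite sqrtr_gt0.
have [i xyi] : exists i, x ord0 i != y ord0 i.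
  apply/existsP; rewrite -negb_forall; apply/negP => /forallP xyi; apply: xy.
  by apply/rowP => i; apply/eqP/xyi.
rewrite (bigD1 i)//= ltr_pwDl ?sumr_ge0//; last by move=> j _; rewrite sqr_ge0.
by rewrite lt_def sqr_ge0 sqrf_eq0 !mxE subr_eq0 xyi.
Qed.

End lebesgue_theory.

(** * Submodularity and lower semicontinuity of the s-perimeter *)

Section perimeter_theory.
Context (R : realType) (n : nat) (s : R).
Local Notation Rn := 'rV[R]_n.+1.
Local Notation T := (lebesgueType R n).
Implicit Types (Omega E F G : set Rn).

Definition kernel (z : T * T) : \bar R := (s_kernel s (z.1 : Rn) z.2)%:E.

(* The pairs of [E `*` F] that meet [Omega]: the domain of integration of the
   s-perimeter when [F] is the complement of [E]. *)
Definition across Omega E F : set (T * T) :=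
  (E : set T) `*` (F : set T) `&` [set z | Omega z.1 \/ Omega z.2].

Definition energy (S : set (T * T)) : \bar R :=
  (\int[@lebesgue R n \x @lebesgue R n]_(z in S) kernel z)%E.

Lemma in_across Omega E F x y : ((x, y) \in across Omega E F) =
  [&& x \in E, y \in F & (x \in Omega) || (y \in Omega)].
Proof.
apply/idP/idP => [/set_mem [[/= Ex Fy] /= O]|/and3P[/set_mem Ex /set_mem Fy /orP O]].
  by rewrite (mem_set Ex) (mem_set Fy); case: O => O; rewrite (mem_set O) ?orbT.
by apply/mem_set; split => //=; case: O => /set_mem; [left|right].
Qed.

Lemma across_measurable Omega E F : lebesgue_measurable Omega ->
  lebesgue_measurable E -> lebesgue_measurable F ->
  measurable (across Omega E F).
Proof.
move=> mO mE mF; rewrite /across; apply: measurableI; first exact: measurableX.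
rewrite (_ : [set z | _] = ((Omega : set T) `*` setT) `|` (setT `*` (Omega : set T))).
  by apply: measurableU; apply: measurableX.
by apply/seteqP; split => -[x y] /=; tauto.
Qed.

Lemma kernel_measurable : measurable_fun setT kernel.
Proof. by apply/measurable_EFinP; exact: (@s_kernel_measurable R n s). Qed.

Lemma kernel_restrict_ge0 (S : set (T * T)) z : (0 <= (kernel \_ S) z)%E.
Proof. by apply: erestrict_ge0 => x _; rewrite lee_fin s_kernel_ge0. Qed.

Lemma kernel_restrict_measurable (S : set (T * T)) :
  measurable S -> measurable_fun setT (kernel \_ S).
Proof.
move=> mS; apply/(measurable_restrictT _ mS).
exact: measurable_funS kernel_measurable.
Qed.

(** Energies of different sets become integrals over one space, so they can be compared
    pointwise. *)
Lemma energyE (S : set (T * T)) : energy S =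
  (\int[@lebesgue R n \x @lebesgue R n]_z (kernel \_ S) z)%E.
Proof. exact: integral_mkcond. Qed.

Lemma energy_ge0 S : (0 <= energy S)%E.
Proof. by rewrite energyE; apply: integral_ge0 => z _; exact: kernel_restrict_ge0. Qed.

Lemma energyU (A B : set (T * T)) : measurable A -> measurable B ->
  [disjoint A & B] -> energy (A `|` B) = (energy A + energy B)%E.
Proof.
move=> mA mB AB; apply: ge0_integral_setU => //.
  exact: measurable_funS kernel_measurable.
by move=> z _; rewrite lee_fin s_kernel_ge0.
Qed.

(** The three interactions live on disjoint products, whose union is the set of pairs in [E] times
    its complement that meet [Omega]. *)
Lemma s_perimeterE Omega E : lebesgue_measurable Omega ->
  lebesgue_measurable E ->
  s_perimeter s E Omega = energy (across Omega E (~` E)).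
Proof.
move=> mO mE; have mOC : measurable (~` Omega : set T) by exact: measurableC.
have mEC : measurable (~` E : set T) by exact: measurableC.
rewrite /s_perimeter /interaction -/kernel.
rewrite -[X in (X + _ + _)%E]/(energy _) -[X in (_ + X + _)%E]/(energy _).
rewrite -[X in (_ + X)%E]/(energy _) -!energyU.
- congr energy; apply/seteqP; split => -[x y] /=.
    by rewrite /across/=; tauto.
  rewrite /across => -[[/= Ex Ey] /= O].
  by have [?|?] := pselect (Omega x); have [?|?] := pselect (Omega y); tauto.
all: do ?by do ?[apply: measurableU]; apply: measurableX; apply: measurableI.
all: by rewrite disj_set2E; apply/eqP/seteqP; split => -[x y] //=; tauto.
Qed.

Lemma s_perimeter_ge0 Omega E : (0 <= s_perimeter s E Omega)%E.
Proof.
have ge0 A B : (0 <= interaction s A B :> \bar R)%E.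
  by apply: integral_ge0 => z _; rewrite lee_fin s_kernel_ge0.
by rewrite adde_ge0// adde_ge0.
Qed.

(** Holds pointwise in the pair [(x, y)]. The two sides differ, before the last energy is added,
    only if one point is in [E \ F] and the other in [F \ E]; that energy counts one of the two
    orders. *)
Lemma s_perimeter_submodular Omega E F : lebesgue_measurable Omega ->
  lebesgue_measurable E -> lebesgue_measurable F ->
  (s_perimeter s (E `&` F) Omega + s_perimeter s (E `|` F) Omega +
     energy (across Omega (E `\` F) (F `\` E)) <=
   s_perimeter s E Omega + s_perimeter s F Omega)%E.
Proof.
move=> mO mE mF.
have mI : lebesgue_measurable (E `&` F) by exact: measurableI.
have mU : lebesgue_measurable (E `|` F) by exact: measurableU.
rewrite !s_perimeterE//.
have mA X : lebesgue_measurable X -> measurable (across Omega X (~` X)).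
  by move=> mX; apply: across_measurable => //; exact: measurableC.
have mG : measurable (across Omega (E `\` F) (F `\` E)).
  by apply: across_measurable => //; exact: measurableD.
rewrite !energyE -!ge0_integralD//;
  do ?[by move=> *; rewrite ?adde_ge0 ?kernel_restrict_ge0
      |by apply: kernel_restrict_measurable; try exact: mA].
  apply: ge0_le_integral => //.
  - by move=> *; rewrite !adde_ge0 ?kernel_restrict_ge0.
  - by do 2 ?[apply: emeasurable_funD]; apply: kernel_restrict_measurable; try exact: mA.
  - by apply: emeasurable_funD; apply: kernel_restrict_measurable; exact: mA.
  move=> -[x y] _; rewrite !patchE !in_across !(in_setI, in_setU, in_setD, in_setC).
  have k0 : (0 <= kernel (x, y))%E by rewrite lee_fin s_kernel_ge0.
  (* Off its domain a restricted function takes the value [point], here 0. *)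
  rewrite -[point]/(0%E : \bar R).
  by case: (x \in E); case: (x \in F); case: (y \in E); case: (y \in F);
    case: (_ || _); rewrite /= ?adde0 ?add0e ?leeDl.
by apply: emeasurable_funD; apply: kernel_restrict_measurable; exact: mA.
Qed.

(** Otherwise the kernel vanishes almost everywhere on the domain. By disjointness the domain avoids
    the diagonal, so the kernel is positive there and the rectangle of [E & Omega] and [F] would be
    null. *)
Lemma energy_across_gt0 Omega E F : lebesgue_measurable Omega ->
  lebesgue_measurable E -> lebesgue_measurable F -> E `&` F = set0 ->
  (0 < @lebesgue R n (E `&` Omega))%E -> (0 < @lebesgue R n F)%E ->
  (0 < energy (across Omega E F))%E.
Proof.
move=> mO mE mF EF0 E0 F0; rewrite lt_def energy_ge0 andbT; apply/eqP => G0.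
have mG := across_measurable mO mE mF.
have : ae_eq (@lebesgue R n \x @lebesgue R n)%E (across Omega E F) kernel (cst 0%E).
  apply/ae_eq_integral_abs => //; first exact: measurable_funS kernel_measurable.
  rewrite -G0 /energy; apply: eq_integral => z _.
  by rewrite gee0_abs// lee_fin s_kernel_ge0.
move=> [N [mN N0 subN]].
have : ((@lebesgue R n \x @lebesgue R n)%E (((E `&` Omega) : set T) `*` (F : set T)) <= 0)%E.
  rewrite -N0; apply: le_measure; rewrite ?inE//.
    by apply: measurableX => //; exact: measurableI.
  move=> [x y] [/= [Ex Ox] Fy]; apply: subN => /= K0.
  have /K0[] : across Omega E F (x, y) by split => //; left.
  apply/eqP; rewrite gt_eqF// s_kernel_gt0// => xy.
  by have : (E `&` F) x by [split => //; rewrite xy]; rewrite EF0.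
rewrite product_measure1E//; last exact: measurableI.
by apply/negP; rewrite -ltNge mule_gt0.
Qed.

(** Fatou's lemma: at each pair both memberships stabilize, so the restricted kernels are eventually
    constant. *)
Lemma s_perimeter_lower_limit Omega (E : nat -> set Rn) F c :
  lebesgue_measurable Omega -> (forall k, lebesgue_measurable (E k)) ->
  lebesgue_measurable F -> (forall x, \forall k \near \oo, E k x <-> F x) ->
  (\forall k \near \oo, (s_perimeter s (E k) Omega <= c)%E) ->
  (s_perimeter s F Omega <= c)%E.
Proof.
move=> mO mE mF EF Ec.
have mA X : lebesgue_measurable X -> measurable (across Omega X (~` X)).
  by move=> mX; apply: across_measurable => //; exact: measurableC.
rewrite s_perimeterE// energyE.
pose f k := kernel \_ (across Omega (E k) (~` E k)).
rewrite (eq_integral (fun z => limn_einf (f^~ z))); last first.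
  move=> [x y] _.
  suff /cvg_limn_einf_sup[-> //] : f^~ (x, y) @ \oo -->
    (kernel \_ (across Omega F (~` F))) (x, y).
  apply: cvg_near_cst; have := EF x; have := EF y; apply: filterS2 => k Ey Ex.
  rewrite /f !patchE !in_across !in_setC.
  by have -> : (x \in E k) = (x \in F) by [apply/idP/idP => /set_mem/Ex/mem_set];
    have -> : (y \in E k) = (y \in F) by [apply/idP/idP => /set_mem/Ey/mem_set].
apply: le_trans (fatou _ measurableT _ _) _.
- by move=> k; apply: kernel_restrict_measurable; exact: mA.
- by move=> k z _; exact: kernel_restrict_ge0.
rewrite limn_einf_lim; apply: lime_le; first exact: is_cvg_einfs.
apply: filterS Ec => k; rewrite s_perimeterE// energyE; apply: le_trans.
by apply: ereal_inf_lbound; exists k; rewrite /=.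
Qed.

End perimeter_theory.

(** * Inclusion and equality up to null sets; exterior data *)

Section ae_sets.
Context (R : realType) (n : nat).
Local Notation Rn := 'rV[R]_n.+1.
Local Notation leb := (@lebesgue R n).
Implicit Types (Omega A B C E F G : set Rn).

Lemma lebesgue_null_sub A B : A `<=` B -> leb B = 0%E -> leb A = 0%E.
Proof.
move=> AB B0; apply/eqP; rewrite eq_le lebesgue_outer_ge0 andbT -B0.
exact: le_lebesgue_outer.
Qed.

Lemma lebesgue_null_bigcup A (B : nat -> set Rn) :
  A `<=` \bigcup_k B k -> (forall k, leb (B k) = 0%E) -> leb A = 0%E.
Proof.
move=> /lebesgue_null_sub AB B0; apply: AB; apply/eqP.
rewrite eq_le lebesgue_outer_ge0 andbT.
apply: le_trans (lebesgue_outer_sigma_subadditive B) _.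
by rewrite eseries0// => k _ _; exact: B0.
Qed.

Lemma lebesgue_null_setU A B : leb A = 0%E -> leb B = 0%E -> leb (A `|` B) = 0%E.
Proof.
move=> A0 B0; apply: (@lebesgue_null_bigcup _ (fun k => if k is 0%N then A else B)).
  by move=> x [Ax|Bx]; [exists 0%N|exists 1%N].
by case.
Qed.

Lemma eq_ae_sym A B : eq_ae A B -> eq_ae B A.
Proof. by rewrite /eq_ae setYC. Qed.

Lemma eq_ae_trans A B C : eq_ae A B -> eq_ae B C -> eq_ae A C.
Proof.
move=> AB BC; apply: lebesgue_null_sub (lebesgue_null_setU AB BC) => x.
by rewrite /setY /=; have [?|?] := pselect (B x); tauto.
Qed.

Lemma eq_subset_ae A B A' B' :
  eq_ae A A' -> eq_ae B B' -> subset_ae A B -> subset_ae A' B'.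
Proof.
move=> AA' BB' AB.
apply: lebesgue_null_sub (lebesgue_null_setU (lebesgue_null_setU AA' BB') AB) => x.
by rewrite /setY /=; have [?|?] := pselect (A x); have [?|?] := pselect (B x); tauto.
Qed.

Lemma subset_ae_le A B : subset_ae A B -> (leb A <= leb B)%E.
Proof.
move=> AB; have : A `<=` (A `\` B) `|` B.
  by move=> x Ax; have [?|?] := pselect (B x); [right|left].
move=> /le_lebesgue_outer/le_trans; apply.
by rewrite -[leRHS]add0e -AB; apply: outer_measureU2.
Qed.

(** Strictness is the failure of the reverse inclusion, and inclusion up to null sets is invariant
    under [eq_ae]. *)
Lemma proper_ae_transfer A B A' B' : eq_ae A A' -> eq_ae B B' ->
  proper_ae A B -> proper_ae A' B'.
Proof.
move=> AA' BB' [AB BA]; split; first exact: eq_subset_ae AB.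
rewrite lt_def lebesgue_outer_ge0 andbT; apply/eqP => /eq_subset_ae BA'.
by move: BA; rewrite BA' ?ltxx//; exact: eq_ae_sym.
Qed.

(* At each point, [F] agrees with some [E k]; this covers finite unions and
   intersections as well as pointwise limits. *)
Lemma same_exterior_pointwise Omega (E : nat -> set Rn) F G :
  (forall k, same_exterior Omega (E k) G) ->
  (forall x, exists k, E k x <-> F x) -> same_exterior Omega F G.
Proof.
move=> EG EF; apply: lebesgue_null_bigcup EG => x.
have [k EFk] := EF x.
by rewrite /setY /= => Fx; exists k => //=; tauto.
Qed.

Lemma same_exterior_setI Omega E F G : same_exterior Omega E G ->
  same_exterior Omega F G -> same_exterior Omega (E `&` F) G.
Proof.
move=> EG FG.
apply: (@same_exterior_pointwise _ (fun k => if k is 0%N then E else F)).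
  by case.
(* On [E] the intersection agrees with [F], off [E] it agrees with [E]. *)
move=> x; have [Ex|Ex] := pselect (E x); [exists 1%N|exists 0%N] => /=; tauto.
Qed.

Lemma same_exterior_setU Omega E F G : same_exterior Omega E G ->
  same_exterior Omega F G -> same_exterior Omega (E `|` F) G.
Proof.
move=> EG FG.
apply: (@same_exterior_pointwise _ (fun k => if k is 0%N then E else F)).
  by case.
move=> x; have [Ex|Ex] := pselect (E x); [exists 0%N|exists 1%N] => /=; tauto.
Qed.

(** With nested exterior data, the intersection competes with the smaller set and, by the next
    lemma, the union with the larger one. *)
Lemma subset_ae_same_exteriorI Omega E F : subset_ae (E `\` Omega) (F `\` Omega) ->
  same_exterior Omega (E `&` F) E.
Proof. by apply: lebesgue_null_sub => x; rewrite /setY /=; tauto. Qed.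

Lemma subset_ae_same_exteriorU Omega E F : subset_ae (E `\` Omega) (F `\` Omega) ->
  same_exterior Omega (E `|` F) F.
Proof. by apply: lebesgue_null_sub => x; rewrite /setY /=; tauto. Qed.

End ae_sets.

(** * Existence and comparison of minimizers *)

Section minimizers.
Context (R : realType) (n : nat) (s : R) (Omega : set 'rV[R]_n.+1).
Hypothesis mOmega : lebesgue_measurable Omega.
Local Notation Rn := 'rV[R]_n.+1.
Local Notation leb := (@lebesgue R n).
Local Notation P E := (s_perimeter s E Omega).
Implicit Types (E F G : set Rn).

Lemma minimizer_comparison E F : s_minimal s Omega E -> s_minimal s Omega F ->
  (P E < +oo)%E -> (P F < +oo)%E ->
  proper_ae (E `\` Omega) (F `\` Omega) -> subset_ae E F.
Proof.
move=> [mE minE] [mF minF] Efin Ffin [EF FE].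
have mI : lebesgue_measurable (E `&` F) by exact: measurableI.
have mU : lebesgue_measurable (E `|` F) by exact: measurableU.
have mEF : lebesgue_measurable (E `\` F) by exact: measurableD.
have mFE : lebesgue_measurable (F `\` E) by exact: measurableD.
have PI := minE _ mI (subset_ae_same_exteriorI EF).
have PU := minF _ mU (subset_ae_same_exteriorU EF).
have sub := s_perimeter_submodular s mOmega mE mF.
(* Minimality bounds the right-hand side of submodularity by the sum for intersection and union;
   this sum is finite and cancels. *)
have gap0 : energy s (across Omega (E `\` F) (F `\` E)) = 0%E.
  apply/eqP; rewrite eq_le energy_ge0 andbT.
  have fin : (P (E `&` F) + P (E `|` F) \is a fin_num)%E.
    rewrite ge0_fin_numE; last by apply: adde_ge0; exact: s_perimeter_ge0.
    apply: le_lt_trans (lte_add_pinfty Efin Ffin).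
    by apply: le_trans sub; rewrite leeDl// energy_ge0.
  by rewrite -(leeD2lE _ _ fin) adde0; apply: le_trans sub (leeD PI PU).
(* [F \ E] has positive measure already outside [Omega], so a non-null part of [E \ F] in [Omega]
   would give a positive gap. *)
have EFO : leb ((E `\` F) `&` Omega) = 0%E.
  apply/eqP; rewrite eq_le lebesgue_outer_ge0 andbT leNgt; apply/negP => EF0.
  suff : (0 < energy s (across Omega (E `\` F) (F `\` E)))%E by rewrite gap0 ltxx.
  apply: energy_across_gt0 => //.
    by apply/seteqP; split => x //= [[? ?] []].
  apply: lt_le_trans FE _; apply: le_lebesgue_outer => x /=; tauto.
apply: lebesgue_null_sub (lebesgue_null_setU EFO EF) => x /= [Ex Fx].
by have [?|?] := pselect (Omega x); tauto.
Qed.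

(** Intersection and union compete with [E], so neither perimeter is below [P E], while their sum is
    at most twice [P E]; finiteness forces equality. *)
Lemma s_minimal_setIU E F : s_minimal s Omega E -> s_minimal s Omega F ->
  (P E < +oo)%E -> same_exterior Omega F E ->
  s_minimal s Omega (E `&` F) /\ s_minimal s Omega (E `|` F).
Proof.
move=> [mE minE] [mF minF] Efin FE.
have mI : lebesgue_measurable (E `&` F) by exact: measurableI.
have mU : lebesgue_measurable (E `|` F) by exact: measurableU.
have EE : same_exterior Omega E E by rewrite /same_exterior /eq_ae setYK; exact: lebesgue_outer0.
have IE := same_exterior_setI EE FE.
have UE := same_exterior_setU EE FE.
have PI := minE _ mI IE; have PU := minE _ mU UE.
have PF : (P F <= P E)%E by apply: minF => //; exact: eq_ae_sym.
have sub : (P (E `&` F) + P (E `|` F) <= P E + P E)%E.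
  apply: le_trans (leeD (lexx _) PF).
  apply: le_trans (s_perimeter_submodular s mOmega mE mF).
  by rewrite leeDl// energy_ge0.
have fin : P E \is a fin_num by rewrite ge0_fin_numE ?s_perimeter_ge0.
have {}PI : (P (E `&` F) <= P E)%E.
  by rewrite -(leeD2rE _ _ fin); apply: le_trans sub; rewrite leeD2l.
have {}PU : (P (E `|` F) <= P E)%E.
  rewrite -(leeD2lE _ _ fin); apply: le_trans sub; rewrite leeD2r//.
  exact: minE.
split; split => // C mC CE; [apply: le_trans PI _|apply: le_trans PU _];
  apply: minE => //; exact: eq_ae_trans CE _.
Qed.

(** * Lower limit of a minimizing sequence *)

Section direct_method.
Variable E : nat -> set Rn.
Hypothesis mE : forall k, lebesgue_measurable (E k).

(** Recursive, so that submodularity adds one set at a time. In the successor branch [N] is still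
    the successor, so the new index is [j + N'.+1]. *)
Fixpoint meet_from j N := if N is N'.+1 then meet_from j N' `&` E (j + N) else E j.

Lemma meet_fromP j N x : meet_from j N x <-> forall k, (k <= N)%N -> E (j + k)%N x.
Proof.
elim: N => [|N IH] /=.
  split=> [Ex k|/(_ 0%N)]; last by rewrite addn0; exact.
  by rewrite leqn0 => /eqP ->; rewrite addn0.
split=> [[/IH Ex EN] k|Ex].
  by rewrite leq_eqVlt => /predU1P[->//|]; exact: Ex.
by split; [apply/IH => k kN; apply: Ex; exact: leqW|exact: Ex].
Qed.

Lemma meet_from_measurable j N : lebesgue_measurable (meet_from j N).
Proof. by elim: N => [|N IH] /=; [exact: mE|apply: measurableI => //; exact: mE]. Qed.

Definition tail j : set Rn := [set x | forall k, E (j + k)%N x].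
Definition inferior : set Rn := \bigcup_j tail j.

Lemma tail_measurable j : lebesgue_measurable (tail j).
Proof.
rewrite /lebesgue_measurable (_ : tail j = \bigcap_k E (j + k)%N); last first.
  by apply/seteqP; split => x Ex k; [move=> _; exact: Ex|exact: (Ex k Logic.I)].
by apply: bigcapT_measurable => k; exact: mE.
Qed.

Lemma inferior_measurable : lebesgue_measurable inferior.
Proof. by apply: bigcupT_measurable => j; exact: tail_measurable. Qed.

(** Stabilization at each point is the form of convergence that [s_perimeter_lower_limit] takes. *)
Lemma meet_from_tail j x : \forall N \near \oo, meet_from j N x <-> tail j x.
Proof.
have [Ex|/existsNP[k Ek]] := pselect (tail j x).
  by apply: nearW => N; split=> // _; apply/meet_fromP => k _; exact: Ex.
near=> N; split=> [/meet_fromP EN|/(_ k)//]; exfalso; apply: Ek; apply: EN.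
by near: N; exact: nbhs_infty_ge.
Unshelve. all: by end_near. Qed.

Lemma tail_inferior x : \forall j \near \oo, tail j x <-> inferior x.
Proof.
have [[j _ Ej]|Ex] := pselect (inferior x).
  near=> i; split=> _; first by exists j.
  move=> k; have ji : (j <= i)%N by near: i; exact: nbhs_infty_ge.
  by rewrite -(subnKC ji) -addnA; exact: Ej.
by apply: nearW => j; split=> // Ej; exfalso; apply: Ex; exists j.
Unshelve. all: by end_near. Qed.

(** [m] will be the infimum over competitors. The errors [2^-k] are summable: from index [j] on they
    total [2 * 2^-j]. *)
Context (G : set Rn) (m : R).
Hypothesis mG : forall F, lebesgue_measurable F -> same_exterior Omega F G ->
  (m%:E <= P F)%E.
Hypothesis EG : forall k, same_exterior Omega (E k) G.
Hypothesis PE : forall k, (P (E k) <= (m + 2^-1 ^+ k)%:E)%E.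

Lemma meet_from_same_exterior j N : same_exterior Omega (meet_from j N) G.
Proof. by elim: N => [|N IH] /=; [exact: EG|exact: same_exterior_setI (EG _)]. Qed.

Lemma tail_same_exterior j : same_exterior Omega (tail j) G.
Proof.
apply: (same_exterior_pointwise (meet_from_same_exterior j)) => x.
by have [N _ /(_ N (leqnn N))] := meet_from_tail j x; exists N.
Qed.

Lemma inferior_same_exterior : same_exterior Omega inferior G.
Proof.
apply: (same_exterior_pointwise tail_same_exterior) => x.
by have [N _ /(_ N (leqnn N))] := tail_inferior x; exists N.
Qed.

(** The bound is [m] plus the sum of [2^-k] for [k] from [j] to [j + N]. The union in each
    submodularity step is a competitor, hence costs at least [m], so a new set adds only its own
    error. *)
Lemma s_perimeter_meet_from j N :
  (P (meet_from j N) <= (m + (2 * 2^-1 ^+ j - 2^-1 ^+ (j + N)))%:E)%E.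
Proof.
elim: N => [|N IH] /=.
  by rewrite addn0 (le_trans (PE j))// lee_fin; lra.
set F := meet_from j N in IH *; set E' := E _.
have mF : lebesgue_measurable F by exact: meet_from_measurable.
have mE' : lebesgue_measurable E' by exact: mE.
have mU : lebesgue_measurable (F `|` E') by exact: measurableU.
have PU : (m%:E <= P (F `|` E'))%E.
  apply: mG => //; apply: same_exterior_setU; last exact: EG.
  exact: meet_from_same_exterior.
have : (P (F `&` E') + m%:E <= (m + (2 * 2^-1 ^+ j - 2^-1 ^+ (j + N)))%:E +
    (m + 2^-1 ^+ (j + N.+1))%:E)%E.
  apply: le_trans (leeD IH (PE _)).
  apply: le_trans (s_perimeter_submodular s mOmega mF mE').
  by apply: le_trans (leeD2l _ PU) _; rewrite leeDl// energy_ge0.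
rewrite -leeBrDr// => /le_trans; apply.
rewrite -EFinD lee_fin addnS exprS; set a := _ ^+ j; set b := _ ^+ _; lra.
Qed.

Lemma s_perimeter_tail j : (P (tail j) <= (m + 2 * 2^-1 ^+ j)%:E)%E.
Proof.
apply: (s_perimeter_lower_limit (E := meet_from j)) => //.
- exact: meet_from_measurable.
- exact: tail_measurable.
- exact: meet_from_tail.
apply: nearW => N; apply: le_trans (s_perimeter_meet_from j N) _.
by rewrite lee_fin lerD2l gerBl exprn_ge0.
Qed.

Lemma s_perimeter_inferior : (P inferior <= m%:E)%E.
Proof.
apply/lee_addgt0Pr => e e0.
apply: (s_perimeter_lower_limit (E := tail)) => //.
- exact: tail_measurable.
- exact: inferior_measurable.
- exact: tail_inferior.
have : 2 * 2^-1 ^+ j @[j --> \oo] --> (2 * 0 : R).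
  by apply: cvgMr; apply: cvg_expr; rewrite ger0_norm; lra.
rewrite mulr0 => /cvgrPdist_le/(_ _ e0); apply: filterS => j.
rewrite sub0r normrN => je; apply: le_trans (s_perimeter_tail j) _.
by rewrite -EFinD lee_fin lerD2l (le_trans (ler_norm _)).
Qed.

End direct_method.

Lemma minimizer_exists G : lebesgue_measurable G ->
  (exists F, [/\ lebesgue_measurable F, same_exterior Omega F G & (P F < +oo)%E]) ->
  exists E, s_minimal s Omega E /\ same_exterior Omega E G.
Proof.
move=> mG [F [mF FG Ffin]].
pose V := [set P F | F in [set F | lebesgue_measurable F /\ same_exterior Omega F G]].
have V0 : (0 <= ereal_inf V)%E.
  by apply: le_ereal_inf_tmp => _ [C _ <-]; exact: s_perimeter_ge0.
(* The admissible set [F] makes the infimum finite, so near-minimizers within [2^-k] exist. *)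
have Vfin : ereal_inf V \is a fin_num.
  by rewrite ge0_fin_numE// (le_lt_trans _ Ffin)//; apply: ereal_inf_lbound; exists F.
have [E EP] : {E : nat -> set Rn & forall k, [/\ lebesgue_measurable (E k),
    same_exterior Omega (E k) G & (P (E k) <= (fine (ereal_inf V) + 2^-1 ^+ k)%:E)%E]}.
  apply: (@choice _ _ (fun k E => [/\ lebesgue_measurable E,
    same_exterior Omega E G & (P E <= (fine (ereal_inf V) + 2^-1 ^+ k)%:E)%E])) => k.
  have k0 : 0 < 2^-1 ^+ k :> R by rewrite exprn_gt0// invr_gt0.
  have [_ [C [mC CG] <-] /ltW PC] := lb_ereal_inf_adherent k0 Vfin.
  by exists C; split => //; rewrite EFinD fineK.
have mE k : lebesgue_measurable (E k) by have [] := EP k.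
have EG k : same_exterior Omega (E k) G by have [] := EP k.
have PE k : (P (E k) <= (fine (ereal_inf V) + 2^-1 ^+ k)%:E)%E by have [] := EP k.
have VG C : lebesgue_measurable C -> same_exterior Omega C G ->
    ((fine (ereal_inf V))%:E <= P C)%E.
  by move=> mC CG; rewrite fineK//; apply: ereal_inf_lbound; exists C.
have infG := inferior_same_exterior EG.
exists (inferior E); split => //; split; first exact: inferior_measurable.
move=> C mC CE; apply: le_trans (s_perimeter_inferior mE VG EG PE) _.
by apply: VG => //; exact: eq_ae_trans infG.
Qed.

(** The union is the intersection plus the symmetric difference. The latter is null outside [Omega]
    but not null, so it has positive volume in [Omega]; the volumes there are finite, hence strictly
    ordered. *)
Lemma distinct_minimizers_gap E F G : (leb Omega < +oo)%E ->
  s_minimal s Omega E -> s_minimal s Omega F -> (P E < +oo)%E ->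
  same_exterior Omega E G -> same_exterior Omega F G -> ~ eq_ae F E ->
  exists A B, [/\ s_minimal s Omega A, s_minimal s Omega B,
    same_exterior Omega A G, same_exterior Omega B G &
    exists q : rat, (leb (A `&` Omega) < (ratr q)%:E < leb (B `&` Omega))%E].
Proof.
move=> Ofin minE minF Efin EG FG FE.
have FE' : same_exterior Omega F E by apply: eq_ae_trans FG _; exact: eq_ae_sym.
have [minI minU] := s_minimal_setIU minE minF Efin FE'.
exists (E `&` F), (E `|` F); split => //; first exact: same_exterior_setI.
  exact: same_exterior_setU.
have fin C : leb (C `&` Omega) \is a fin_num.
  rewrite ge0_fin_numE ?lebesgue_outer_ge0// (le_lt_trans _ Ofin)//.
  by apply: le_lebesgue_outer => x [].
have mD : lebesgue_measurable ((F `+` E) `&` Omega).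
  apply: measurableI => //; apply: measurableU; apply: measurableD;
  by first [exact: minE.1|exact: minF.1].
have : (leb (E `&` F `&` Omega) < leb ((E `|` F) `&` Omega))%E.
  rewrite (_ : (E `|` F) `&` Omega = (E `&` F `&` Omega) `|` ((F `+` E) `&` Omega)).
    rewrite [ltRHS]measureU//.
    - rewrite lteDl ?fin// lt_def lebesgue_outer_ge0 andbT; apply/eqP => D0.
      apply: FE; apply: lebesgue_null_sub (lebesgue_null_setU D0 FE') => x.
      by rewrite /setY /=; have [?|?] := pselect (Omega x); tauto.
    - by apply: measurableI => //; exact: minI.1.
    - by apply/seteqP; split => x //; rewrite /setY /=; tauto.
  apply/seteqP; split => x; rewrite /setY /=; last by tauto.
  by have [?|?] := pselect (E x); have [?|?] := pselect (F x); tauto.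
rewrite -(fineK (fin (E `&` F))) -(fineK (fin (E `|` F))) lte_fin.
move=> /rat_in_itvoo[q]; rewrite in_itv/= => ?.
by exists q; rewrite !lte_fin.
Qed.

End minimizers.

(** * Countability of the exceptional parameters *)

Theorem theorem1p1 (R : realType) (n : nat) (s : R) (hs : 0 < s < 1)
    (Omega : set 'rV[R]_n.+1) (hOmega : bounded_domain Omega)
    (I : set R) (G : R -> set 'rV[R]_n.+1)
    (mG : forall t, I t -> lebesgue_measurable (G t))
    (finG : forall t, I t -> exists F : set 'rV[R]_n.+1,
       [/\ lebesgue_measurable F, same_exterior Omega F (G t)
         & (s_perimeter s F Omega < +oo)%E])
    (monoG : forall t1 t2, I t1 -> I t2 -> t1 < t2 ->
       proper_ae (G t1 `\` Omega) (G t2 `\` Omega)) :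
  exists N : set R,
    [/\ N `<=` I, countable N
      & forall t, (I `\` N) t ->
          exists E : set 'rV[R]_n.+1,
            [/\ s_minimal s Omega E, same_exterior Omega E (G t)
              & forall E' : set 'rV[R]_n.+1,
                  s_minimal s Omega E' -> same_exterior Omega E' (G t) ->
                  eq_ae E' E]].
Proof.
have [oO _ _ /bounded_lebesgue finO] := hOmega.
have mO := open_lebesgue_measurable oO.
(* A minimizer does no worse than the admissible set of finite perimeter. *)
have min_fin t E : I t -> s_minimal s Omega E -> same_exterior Omega E (G t) ->
    (s_perimeter s E Omega < +oo)%E.
  move=> It [_ minE] EG; have [F [mF FG Ffin]] := finG _ It.
  by apply: le_lt_trans Ffin; apply: minE => //; apply: eq_ae_trans FG _; exact: eq_ae_sym.
pose separates t (q : rat) := exists A B, [/\ s_minimal s Omega A,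
  s_minimal s Omega B, same_exterior Omega A (G t), same_exterior Omega B (G t) &
  (@lebesgue R n (A `&` Omega) < (ratr q)%:E < @lebesgue R n (B `&` Omega))%E].
pose N := [set t | I t /\ exists q, separates t q].
(* By comparison the set [B] above [q1] lies in the set [A] below [q2], so
   [q1 < |B & Omega| <= |A & Omega| < q2]. *)
have separates_lt t1 t2 q1 q2 : I t1 -> I t2 -> t1 < t2 ->
    separates t1 q1 -> separates t2 q2 -> q1 < q2.
  move=> I1 I2 t12 [_ [B [_ minB _ BG /andP[_ qB]]]] [A [_ [minA _ AG _ /andP[Aq _]]]].
  rewrite -(ltr_rat R) -lte_fin; apply: lt_trans qB _.
  apply: le_lt_trans Aq; apply: subset_ae_le.
  have : subset_ae B A.
    apply: (minimizer_comparison mO minB minA);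
      [exact: min_fin I1 minB BG|exact: min_fin I2 minA AG|].
    by apply: proper_ae_transfer (monoG _ _ I1 I2 t12); exact: eq_ae_sym.
  by apply: lebesgue_null_sub => x /=; tauto.
exists N; split => [t []//||t [It Nt]].
  (* One rational is chosen for each parameter; off [N] the value 0 is a dummy. *)
  have [q qP] : {q : R -> rat & forall t, N t -> separates t (q t)}.
    apply: (@choice _ _ (fun t q => N t -> separates t q)) => t.
    have [[It [q sq]]|Nt] := pselect (N t); first by exists q.
    by exists 0.
  (* Strict monotonicity makes [q] injective on [N]; [pickle] then codes rationals as naturals. *)
  apply/countable_injP; exists (choice.pickle \o q) => t1 t2.
  rewrite !inE => N1 N2 /(pcan_inj choice.pickleK) q12.
  have [t12|t21|//] := ltgtP t1 t2.
  - have := separates_lt _ _ _ _ N1.1 N2.1 t12 (qP _ N1) (qP _ N2).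
    by rewrite q12 ltxx.
  - have := separates_lt _ _ _ _ N2.1 N1.1 t21 (qP _ N2) (qP _ N1).
    by rewrite q12 ltxx.
have [E [minE EG]] := minimizer_exists mO (mG _ It) (finG _ It).
(* A second minimizer would yield a separating rational and put [t] in [N]. *)
exists E; split => // E' minE' EG'; apply: contrapT => E'E; apply: Nt; split => //.
have [A [B [minA minB AG BG [q ABq]]]] :=
  distinct_minimizers_gap mO finO minE minE' (min_fin _ _ It minE EG) EG EG' E'E.
by exists q, A, B.
Qed.
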